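(* There exists a universal constant $c>0$ such that for every finite, simple, connected graph $G=(V,E)$ with $n\ge 2$ vertices, every weight function $m$ on $G$, and every metric space $(X,d_X)$ with at least two points, $$\frac{\lambda(G,X)}{\mu_1(G)}\ge\frac{c}{(\log n)^2}.$$
   Context: For a graph $G=(V,E)$, let $\vec{E}=\{(x,y)\in V\times V : \{x,y\}\in E\}$. A weight function on $G$ is a symmetric function $m:V\times V\to[0,\infty)$ whose support equals $\vec{E}$. Write $m(x)=\sum_{y\in V}m(x,y)$ and $m(\emptyset)=\sum_{x\in V}m(x)$. For a metric space $(X,d_X)$ with at least two points, the nonlinear spectral gap $\lambda(G,X)$ of the weighted graph $(G,m)$ is the reciprocal of the smallest constant $C>0$ such that for every map $f:V\to X$ $$\frac{1}{m(\emptyset)}\sum_{x,y\in V}m(x)m(y)\,d_X(f(x),f(y))^2\le C\sum_{x,y\in V}m(x,y)\,d_X(f(x),f(y))^2 .$$ $\mu_1(G)$ is the first positive eigenvalue of the combinatorial Laplacian $\Delta$ of $(G,m)$, acting on $f:V\to\mathbb{R}$ by $\Delta f(x)=f(x)-\sum_{y\in V}\frac{m(x,y)}{m(x)}f(y)$; it equals $\lambda(G,\mathbb{R})$. *)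

(* Defs.v *)
From HB Require Import structures.
From mathcomp Require Import all_boot all_order all_algebra.
From mathcomp Require Import all_classical all_reals all_analysis.

Set Implicit Arguments.
Unset Strict Implicit.
Unset Printing Implicit Defensive.

Import Order.TTheory GRing.Theory Num.Theory.
Import numFieldNormedType.Exports.

Local Open Scope classical_set_scope.
Local Open Scope ring_scope.

(* A graph on the finite vertex type V is given by its adjacency relation e. *)
Definition simple_graph (V : finType) (e : rel V) : Prop :=
  symmetric e /\ irreflexive e.

Definition connected_graph (V : finType) (e : rel V) : Prop :=
  forall x y : V, connect e x y.

Definition weight_function (R : realType) (V : finType) (e : rel V)
    (m : V -> V -> R) : Prop :=
  [/\ forall x y, m x y = m y x,
      forall x y, 0 <= m x y
    & forall x y, (m x y != 0) = e x y].

Definition vertex_weight (R : realType) (V : finType) (m : V -> V -> R)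
    (x : V) : R :=
  \sum_(y : V) m x y.

Definition total_weight (R : realType) (V : finType) (m : V -> V -> R) : R :=
  \sum_(x : V) vertex_weight m x.

Definition poincare_inequality (R : realType) (V : finType) (m : V -> V -> R)
    (X : metricType R) (C : R) : Prop :=
  forall f : V -> X,
    (total_weight m)^-1 *
      (\sum_(x : V) \sum_(y : V)
         vertex_weight m x * vertex_weight m y * mdist (f x) (f y) ^+ 2)
    <= C * (\sum_(x : V) \sum_(y : V) m x y * mdist (f x) (f y) ^+ 2).

(* On a connected graph with at least two vertices, and for X with at least two
   points, the set below is nonempty, and its infimum is positive and attained,
   hence is the smallest admissible constant. *)
Definition nonlinear_spectral_gap (R : realType) (V : finType)
    (m : V -> V -> R) (X : metricType R) : R :=
  (inf [set C : R | 0 < C /\ poincare_inequality m X C])^-1.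

Definition laplacian (R : realType) (V : finType) (m : V -> V -> R)
    (f : {ffun V -> R^o}) : {ffun V -> R^o} :=
  [ffun x => f x - \sum_(y : V) m x y / vertex_weight m x * f y].

Lemma laplacian_is_linear (R : realType) (V : finType) (m : V -> V -> R) :
  linear (laplacian m).
Proof.
move=> a f g; apply/ffunP => x; rewrite !ffunE scalerBr scaler_sumr.
rewrite addrACA -opprD -big_split /=; congr (_ - _); apply: eq_bigr => y _.
by rewrite !ffunE mulrDr; congr (_ + _); rewrite /GRing.scale /= mulrCA.
Qed.

HB.instance Definition _ (R : realType) (V : finType) (m : V -> V -> R) :=
  GRing.isLinear.Build R {ffun V -> R^o} {ffun V -> R^o} *:%R (laplacian m)
    (laplacian_is_linear m).

Lemma leigenvalue_laplacianP (R : realType) (V : finType) (m : V -> V -> R)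
    (a : R) :
  passmx.leigenvalue (linfun (laplacian m)) a <->
  exists2 f : {ffun V -> R^o}, f != 0 & laplacian m f = a *: f.
Proof.
have mem_eig f : (f \in passmx.leigenspace (linfun (laplacian m)) a) =
                 (laplacian m f == a *: f).
  rewrite memv_ker !lfun_simp -[LHS]subr_eq0 subr0.
  by rewrite subr_eq0.
split=> [eig_a | [f f0 /eqP fE]].
  exists (vpick (passmx.leigenspace (linfun (laplacian m)) a)).
    by rewrite vpick0.
  by apply/eqP; rewrite -mem_eig memv_pick.
apply/eqP => eig0; move: fE; rewrite -mem_eig eig0 memv0.
exact/negP.
Qed.

(* The smallest positive eigenvalue; the spectrum is finite, and contains a
   positive number when the graph is connected with at least two vertices. *)
Definition mu1 (R : realType) (V : finType) (m : V -> V -> R) : R :=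
  inf [set a : R | 0 < a /\ passmx.leigenvalue (linfun (laplacian m)) a].

(* Main.v *)
(* By Bourgain's embedding theorem, the pseudometric d(x, y) = d_X(f x, f y) on
   the n vertices is, up to a factor O(log n), an average of squared differences
   of 1-Lipschitz real functions, namely distances to random sets A containing
   each vertex independently with probability 2^-j, for 1 <= j <= L with
   L = O(log n).  Applying the Poincare inequality of the real line, whose
   constant is 1 / mu_1, to each of these functions and averaging gives the one
   for X with constant O(log^2 n) / mu_1.

   That mu_1 governs the real inequality is the variational principle: a
   minimiser of the Rayleigh quotient exists by compactness, and the
   first-order condition makes it an eigenfunction of the Laplacian. *)
Require Import Defs.
From mathcomp Require Import all_boot all_order all_algebra.
From mathcomp Require Import all_classical all_reals all_analysis.
From mathcomp Require Import ring lra.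

Set Implicit Arguments.
Unset Strict Implicit.
Unset Printing Implicit Defensive.

Import Order.TTheory GRing.Theory Num.Theory.
Import numFieldNormedType.Exports.

Local Open Scope ring_scope.

(** * Random vertex sets: missing a small set while hitting a large one *)

Section Bourgain.
Variables (R : realFieldType) (V : finType).

Lemma bernoulli_ineq (x : R) k : -1 <= x -> 1 + x *+ k <= (1 + x) ^+ k.
Proof.
move=> x1; elim: k => [|k IHk]; first by rewrite mulr0n addr0 expr0.
rewrite exprS; apply: le_trans (ler_wpM2l _ IHk); last by lra.
have : 0 <= x * (x *+ k) by rewrite mulrnAr -expr2 mulrn_wge0 ?sqr_ge0.
by rewrite mulrS; nra.
Qed.

(** Bernoulli's inequality bounds [(1 - p) ^+ k.+1] below by 1 / 2, since [p *+ k.+1] is 1 / 2;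
    squaring reaches the exponent [2 * k.+1]. *)
Lemma miss_small_prob k i : (i <= 2 * k.+1)%N ->
  4^-1 <= (1 - (2 * k.+1)%:R^-1 : R) ^+ i.
Proof.
set p : R := (2 * k.+1)%:R^-1 => ik.
have p0 : 0 < p by rewrite invr_gt0 ltr0n.
have kp : p *+ k.+1 = 2^-1.
  by rewrite -[LHS]mulr_natr /p natrM invfM -mulrA mulVf ?mulr1 ?pnatr_eq0.
have p2 : p <= 2^-1 by rewrite -kp mulrS lerDl mulrn_wge0 // ltW.
have h : 2^-1 <= (1 - p) ^+ k.+1.
  apply: le_trans (bernoulli_ineq _ _); last by lra.
  by rewrite mulNrn kp; lra.
apply: (@le_trans _ _ ((1 - p) ^+ (2 * k.+1))); last first.
  by apply: ler_wiXn2l => //; lra.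
by rewrite mulnC exprM expr2; nra.
Qed.

(** Bernoulli's inequality gives [(1 + p) ^+ k.+1] at least 3 / 2, and its product with
    [(1 - p) ^+ k.+1] is at most 1. *)
Lemma hit_big_prob k i : (k.+1 <= i)%N ->
  (1 - (2 * k.+1)%:R^-1 : R) ^+ i <= 2 / 3.
Proof.
set p : R := (2 * k.+1)%:R^-1 => ik.
have p0 : 0 < p by rewrite invr_gt0 ltr0n.
have kp : p *+ k.+1 = 2^-1.
  by rewrite -[LHS]mulr_natr /p natrM invfM -mulrA mulVf ?mulr1 ?pnatr_eq0.
have p2 : p <= 2^-1 by rewrite -kp mulrS lerDl mulrn_wge0 // ltW.
apply: (@le_trans _ _ ((1 - p) ^+ k.+1)).
  by apply: ler_wiXn2l => //; lra.
have h : 3 / 2 <= (1 + p) ^+ k.+1.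
  by apply: le_trans (bernoulli_ineq _ _); rewrite ?kp; lra.
have a0 : 0 <= (1 - p) ^+ k.+1 by apply: exprn_ge0; lra.
have : (1 - p) ^+ k.+1 * (1 + p) ^+ k.+1 <= 1.
  by rewrite -exprMn; apply: exprn_ile1; nra.
nra.
Qed.

(** The probability of drawing exactly [A] when each vertex is taken independently with probability
    [p]. *)
Definition bernoulli_weight (p : R) (A : {set V}) : R :=
  \prod_x (if x \in A then p else 1 - p).

Lemma bernoulli_weight_ge0 p A : 0 <= p <= 1 -> 0 <= bernoulli_weight p A.
Proof.
by case/andP=> p0 p1; apply: prodr_ge0 => x _; case: ifP; rewrite ?subr_ge0.
Qed.

(** Replacing [p] by 0 on [B] kills exactly the sets meeting [B]; the sum over all sets then factors
    over the vertices. *)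
Lemma bernoulli_weight_disjoint p (B : {set V}) :
  \sum_(A : {set V} | [disjoint A & B]) bernoulli_weight p A = (1 - p) ^+ #|B|.
Proof.
transitivity (\prod_x ((if x \in B then 0 else p) + (1 - p))).
  rewrite bigA_distr big_mkcond; apply: eq_bigr => A _.
  case: ifPn => [AB|].
    apply: eq_bigr => x _; case: ifPn => // xA.
    by rewrite (disjointFr AB xA).
  rewrite -finset.setI_eq0 => /finset.set0Pn[x /[!finset.inE]/andP[xA xB]].
  by rewrite (bigD1 x) //= xA xB mul0r.
rewrite (bigID (mem B)) /= [X in _ * X]big1 ?mulr1; last first.
  by move=> x /negbTE ->; rewrite addrC subrK.
rewrite (eq_bigr (fun=> 1 - p)) ?prodr_const //.
by move=> x ->; rewrite add0r.
Qed.

Lemma sum_bernoulli_weight p : \sum_(A : {set V}) bernoulli_weight p A = 1.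
Proof.
rewrite -[RHS](expr0 (1 - p)) -(finset.cards0 V) -bernoulli_weight_disjoint.
by apply: eq_bigl => A; rewrite disjoint_sym finset.disjoints_subset finset.sub0set.
Qed.

(** Disjointness makes the two events independent: [B1] is missed with probability at least 1 / 4
    and [B2] is hit with probability at least 1 - 2 / 3, whence 1 / 12. *)
Lemma bernoulli_weight_separate k (B1 B2 : {set V}) :
    [disjoint B1 & B2] -> (#|B1| <= 2 * k.+1)%N -> (k.+1 <= #|B2|)%N ->
  12^-1 <= \sum_(A : {set V} | [disjoint A & B1] && ~~ [disjoint A & B2])
             bernoulli_weight (2 * k.+1)%:R^-1 A.
Proof.
move=> B12 c1 c2; set p : R := (2 * k.+1)%:R^-1.
have := bernoulli_weight_disjoint p B1.
rewrite (bigID (fun A : {set V} => [disjoint A & B2])) /=.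
have -> : \sum_(A : {set V} | [disjoint A & B1] && [disjoint A & B2])
    bernoulli_weight p A = (1 - p) ^+ #|B1| * (1 - p) ^+ #|B2|.
  rewrite -exprD -cardsUI (_ : B1 :&: B2 = finset.set0) ?finset.cards0 ?addn0; last first.
    by apply/eqP; rewrite finset.setI_eq0.
  rewrite -bernoulli_weight_disjoint; apply: eq_bigl => A.
  by rewrite -!finset.setI_eq0 finset.setIUr finset.setU_eq0.
have := miss_small_prob c1; have := hit_big_prob c2; rewrite -/p.
move: (_ ^+ #|B1|) (_ ^+ #|B2|) => a b; set s := \sum_(_ | _) _.
nra.
Qed.

(* [r] is the k-th smallest value of [g], truncated at [M]. *)
Lemma threshold_radius (g : V -> R) (M : R) k : (0 < k)%N ->
  exists r, [/\ r <= M, (#|[set z | (g z < r)%R]| < k)%N &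
                r = M \/ (k <= #|[set z | (g z <= r)%R]|)%N].
Proof.
move=> k0.
(* The witness is a vertex of largest value below [r]. *)
have low r : (k <= #|[set z | (g z < r)%R]|)%N ->
    exists2 z, g z < r & (k <= #|[set y | (g y <= g z)%R]|)%N.
  move=> kr; have /card_gt0P[z0] := leq_trans k0 kr; rewrite finset.inE => z0r.
  case: (@arg_maxP _ _ _ z0 (fun z => g z < r) g z0r) => z zr zmax.
  exists z => //; apply: leq_trans kr (subset_leq_card _).
  by apply/fintype.subsetP => y; rewrite !finset.inE; apply: zmax.
have [small|/low[z0 z0M z0k]] := ltnP #|[set z | g z < M]| k.
  by exists M; split=> //; left.
(* Take the least value with [k] vertices at or below it; [k] vertices strictly below it would, by
   [low], yield a smaller such value. *)
case: (@arg_minP _ _ _ z0 (fun z => (k <= #|[set y | (g y <= g z)%R]|)%N) g z0k).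
move=> z zk zmin; exists (g z); split; last by right.
  exact: le_trans (zmin _ z0k) (ltW z0M).
by rewrite ltnNge; apply/negP => /low[y yz /zmin]; rewrite leNgt yz.
Qed.

(** * Bourgain's estimate for distances to random sets *)

Section Frechet.
Variables (d : V -> V -> R) (T : R).
Hypothesis dxx : forall x, d x x = 0.
Hypothesis d_ge0 : forall x y, 0 <= d x y.
Hypothesis d_sym : forall x y, d x y = d y x.
Hypothesis d_triangle : forall x y z, d x z <= d x y + d y z.
Hypothesis d_le : forall x y, d x y <= T.

(* The cap [T] only matters for the empty set. *)
Definition set_dist (A : {set V}) (x : V) : R :=
  \big[Num.min/T]_(z in A) d x z.

Lemma set_dist_lipschitz A x y : `|set_dist A x - set_dist A y| <= d x y.
Proof.
have half u v : set_dist A u - d u v <= set_dist A v.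
  apply: le_bigmin => [|z zA].
    by have := bigmin_le_id (index_enum V) T (mem A) (d u); have := d_ge0 u v;
      rewrite /set_dist; lra.
  have := d_triangle u v z; have := bigmin_le_cond T (d u) zA.
  by rewrite /set_dist; lra.
have := half x y; have := half y x; rewrite (d_sym y x) ler_norml.
lra.
Qed.

Lemma le_set_dist (A : {set V}) x r : r <= T ->
  [disjoint A & [set z | d x z < r]] -> r <= set_dist A x.
Proof.
move=> rT dis; apply: le_bigmin => // z zA; rewrite leNgt.
by have := disjointFr dis zA; rewrite finset.inE => ->.
Qed.

Lemma set_dist_le (A : {set V}) x r :
  ~~ [disjoint A & [set z | d x z <= r]] -> set_dist A x <= r.
Proof.
rewrite -finset.setI_eq0 => /finset.set0Pn[z]; rewrite !finset.inE => /andP[zA zr].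
exact: bigmin_inf zA zr.
Qed.

(** A set missing the open [s]-ball around [x] and meeting the closed [r]-ball around [y] has
    distances to [x] and [y] differing by at least [s - r]. The balls are disjoint since
    [r + s <= d x y], so such sets have probability at least 1 / 12. *)
Lemma bernoulli_separation k x y r s :
    (#|[set z | (d x z < s)%R]| <= 2 * k.+1)%N ->
    (k.+1 <= #|[set z | (d y z <= r)%R]|)%N ->
    s <= T -> r + s <= d x y ->
  (s - r) / 12 <= \sum_(A : {set V})
     bernoulli_weight (2 * k.+1)%:R^-1 A * `|set_dist A x - set_dist A y|.
Proof.
move=> cs cr sT rs; set p : R := (2 * k.+1)%:R^-1.
have p01 : 0 <= p <= 1 by rewrite invr_ge0 ler0n invf_le1 ?ltr0n ?ler1n.
have [le_sr|lt_rs] := leP s r.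
  apply: (@le_trans _ _ 0); first by lra.
  by apply: sumr_ge0 => A _; rewrite mulr_ge0 ?bernoulli_weight_ge0.
have dis : [disjoint [set z | d x z < s] & [set z | d y z <= r]].
  rewrite -finset.setI_eq0; apply/eqP/finset.setP => z; rewrite !finset.inE; apply/negP => /andP[].
  by have := d_triangle x z y; rewrite (d_sym z y); lra.
have := bernoulli_weight_separate dis cs cr; rewrite -/p => sep.
rewrite (bigID (fun A : {set V} => [disjoint A & [set z | d x z < s]] &&
                          ~~ [disjoint A & [set z | d y z <= r]])) /=.
rewrite -[leLHS]addr0; apply: lerD; last first.
  by apply: sumr_ge0 => A _; rewrite mulr_ge0 ?bernoulli_weight_ge0.
rewrite mulrC; apply: (le_trans (ler_wpM2r _ sep)); first by lra.
rewrite big_distrl /=; apply: ler_sum => A /andP[A1 A2]; apply: ler_wpM2l.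
  exact: bernoulli_weight_ge0.
have := le_set_dist sT A1; have := set_dist_le A2.
have := ler_norm (set_dist A x - set_dist A y); lra.
Qed.

Lemma bourgain_mean L x y : (#|V| < 2 ^ L)%N ->
  d x y / 48 <= \sum_(j < L) \sum_(A : {set V})
     bernoulli_weight (2 ^ j.+1)%:R^-1 A * `|set_dist A x - set_dist A y|.
Proof.
move=> VL; set D := d x y.
have D0 : 0 <= D := d_ge0 x y.
(* Good radii r_j separate x from y at scale j.+1 by (r_(j+1) - r_j) / 12 on
   average; since r_0 <= 0 and r_L = D / 4, these telescope. Radii at most D / 4
   keep the balls around x and y disjoint. *)
pose good j (r : R) :=
  [/\ r <= D / 4,
      (#|[set z | (d x z < r)%R]| < 2 ^ j)%N \/ (#|[set z | (d y z < r)%R]| < 2 ^ j)%N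
    & r = D / 4 \/ (2 ^ j <= #|[set z | (d x z <= r)%R]|)%N /\
                   (2 ^ j <= #|[set z | (d y z <= r)%R]|)%N].
have ex_good j : exists r, good j r.
  have two : (0 < 2 ^ j)%N by rewrite expn_gt0.
  have [r [rM r1 r2]] := threshold_radius (d x) (D / 4) two.
  have [s [sM s1 s2]] := threshold_radius (d y) (D / 4) two.
  have up (g : V -> R) a b : a <= b -> (2 ^ j <= #|[set z | (g z <= a)%R]|)%N ->
      (2 ^ j <= #|[set z | (g z <= b)%R]|)%N.
    move=> ab ja; apply: leq_trans ja (subset_leq_card _).
    by apply/fintype.subsetP => z; rewrite !finset.inE => /le_trans; apply.
  (* The larger threshold works: its own open ball is small, and both closed balls are large unless
     the cap D / 4 is reached. *)
  have [rs|sr] := leP r s.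
    exists s; split=> //; [by right|].
    case: s2 => [?|s2]; first by left.
    case: r2 => [rE|r2]; first by left; lra.
    by right; split=> //; apply: up r2.
  exists r; split=> //; [by left|].
  case: r2 => [?|r2]; first by left.
  case: s2 => [sE|s2]; first by left; lra.
  by right; split=> //; apply: up s2; apply: ltW.
pose step j r s := (s - r) / 12 <= \sum_(A : {set V})
     bernoulli_weight (2 ^ j.+1)%:R^-1 A * `|set_dist A x - set_dist A y|.
have good_step j r s : good j r -> good j.+1 s -> step j r s.
  move=> [rD _ r2] [sD s1 _]; rewrite /step.
  have [k kE] : exists k, (2 ^ j = k.+1)%N.
    by exists (2 ^ j).-1; rewrite prednK ?expn_gt0.
  (* If [r] has reached the cap D / 4, then [s] cannot exceed it and the left side is
     nonpositive. *)
  case: r2 => [rE|[rx ry]].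
    apply: (@le_trans _ _ 0); first by lra.
    apply: sumr_ge0 => A _; rewrite mulr_ge0 ?bernoulli_weight_ge0 //.
    by rewrite invr_ge0 ler0n invf_le1 ?ltr0n ?ler1n expn_gt0.
  have sT : s <= T by have := d_le x y; rewrite -/D; lra.
  rewrite expnS kE in s1 rx ry *.
  case: s1 => /ltnW s1; first by apply: bernoulli_separation => //; rewrite -/D; lra.
  under eq_bigr do rewrite distrC.
  by apply: bernoulli_separation => //; rewrite d_sym -/D; lra.
have partial l : exists2 r, good l r & r / 12 <= \sum_(j < l) \sum_(A : {set V})
     bernoulli_weight (2 ^ j.+1)%:R^-1 A * `|set_dist A x - set_dist A y|.
  elim: l => [|l [r gr rE]].
    have [r gr] := ex_good 0%N; exists r => //; rewrite big_ord0.
    suff : r <= 0 by lra.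
    (* An open ball of positive radius contains its centre, so it cannot have fewer than 2 ^ 0
       points. *)
    rewrite leNgt; apply/negP => r0; case: gr => _ + _; rewrite expn0 !ltnS !leqn0.
    rewrite !cards_eq0 => -[] /eqP/finset.setP.
      by move=> /(_ x); rewrite !finset.inE dxx r0.
    by move=> /(_ y); rewrite !finset.inE dxx r0.
  have [s gs] := ex_good l.+1; exists s => //; rewrite big_ord_recr /=.
  have := good_step _ _ _ gr gs; rewrite /step; lra.
(* No ball has 2 ^ L points, so the last radius is D / 4, and (D / 4) / 12 = D / 48. *)
have [r [_ _ []]] := partial L; first by move=> ->; lra.
by move=> [/(leq_trans VL)]; rewrite ltnNge max_card.
Qed.

Lemma bourgain_l2 L x y : (#|V| < 2 ^ L)%N ->
  d x y ^+ 2 <= 2304 * L%:R * \sum_(j < L) \sum_(A : {set V})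
     bernoulli_weight (2 ^ j.+1)%:R^-1 A * (set_dist A x - set_dist A y) ^+ 2.
Proof.
move=> VL; have L0 : (0 < L)%N.
  rewrite lt0n; apply/eqP => L0; move: VL.
  by rewrite L0 ltnS leqn0 => /eqP/card0_eq/(_ x).
have := bourgain_mean x y VL; set D := d x y.
have D0 : 0 <= D := d_ge0 x y.
have l0 : 0 < L%:R :> R by rewrite ltr0n.
(* This [t] maximises 2 t D / 48 - t ^ 2 L; the maximum is D ^ 2 / (48 ^ 2 L), and 2304 = 48 ^ 2. *)
set t := D / (48 * L%:R).
have tL : t * L%:R = D / 48 by rewrite /t; field; rewrite gt_eqF.
have t0 : 0 <= t by apply: divr_ge0 => //; apply: mulr_ge0; apply: ler0n.
set S1 := (X in _ <= X -> _); set S2 := (X in _ -> _ <= _ * X) => DS.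
(* AM-GM, [2 t a <= a^2 + t^2], summed against weights of total mass L. *)
suff amgm : 2 * t * S1 <= S2 + t ^+ 2 * L%:R.
  have : t * D / 48 <= S2 by nra.
  rewrite (_ : D ^+ 2 = 2304 * L%:R * (t * D / 48)); last first.
    by rewrite /t; field; rewrite gt_eqF.
  by move=> h; apply: ler_wpM2l h; apply: mulr_ge0; apply: ler0n.
have -> : t ^+ 2 * L%:R = \sum_(j < L) \sum_(A : {set V})
     bernoulli_weight (2 ^ j.+1)%:R^-1 A * t ^+ 2.
  under eq_bigr do rewrite -big_distrl /= sum_bernoulli_weight mul1r.
  by rewrite sumr_const card_ord mulr_natr.
rewrite /S1 /S2 -big_split big_distrr /=; apply: ler_sum => j _.
rewrite -big_split big_distrr /=; apply: ler_sum => A _.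
have w0 : 0 <= bernoulli_weight (2 ^ j.+1)%:R^-1 A.
  by apply: bernoulli_weight_ge0; rewrite invr_ge0 ler0n invf_le1 ?ltr0n ?ler1n expn_gt0.
rewrite -mulrDr mulrCA; apply: ler_wpM2l => //.
rewrite -real_normK ?num_real //.
have := sqr_ge0 (`|set_dist A x - set_dist A y| - t); lra.
Qed.

End Frechet.
End Bourgain.

(** * Dirichlet forms and minimisers of their Rayleigh quotient *)

Section DirichletForm.
Local Open Scope classical_set_scope.
Variables (R : realType) (V : finType).
Implicit Types (w : V -> V -> R) (g h : V -> R).

(** For [g = h], taking [w] to be [m] or the product of vertex weights gives the two double sums of
    the real Poincare inequality. *)
Definition dirichlet w g h : R :=
  \sum_x \sum_y w x y * ((g x - g y) * (h x - h y)).

(** Summation by parts: the terms in [g x] and in [g y] are equal after exchanging the summation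
    indices. *)
Lemma dirichlet_green w g h : (forall x y, w x y = w y x) ->
  dirichlet w g h = 2 * \sum_x g x * \sum_y w x y * (h x - h y).
Proof.
move=> wC; rewrite mulr_natl mulr2n.
transitivity (\sum_x \sum_y (g x * (w x y * (h x - h y)))
            + \sum_x \sum_y (g y * (w y x * (h y - h x)))).
  rewrite -big_split; apply: eq_bigr => x _; rewrite -big_split.
  by apply: eq_bigr => y _; rewrite (wC y x) /=; ring.
by rewrite [X in _ + X]exchange_big /=; congr (_ + _); apply: eq_bigr => x _;
  rewrite big_distrr.
Qed.

Lemma dirichlet_ge0 w h : (forall x y, 0 <= w x y) -> 0 <= dirichlet w h h.
Proof.
move=> w0; apply: sumr_ge0 => x _; apply: sumr_ge0 => y _.
by rewrite mulr_ge0 // -expr2 sqr_ge0.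
Qed.

Lemma dirichlet_eq0 w h : (forall x y, 0 <= w x y) -> dirichlet w h h = 0 ->
  forall x y, w x y != 0 -> h x = h y.
Proof.
move=> w0 /eqP; rewrite psumr_eq0 => [/allP hw x y wxy|x _]; last first.
  by apply: sumr_ge0 => y _; rewrite mulr_ge0 // -expr2 sqr_ge0.
have := hw x (mem_index_enum x); rewrite /= psumr_eq0 => [|z _]; last first.
  by rewrite mulr_ge0 // -expr2 sqr_ge0.
move=> /allP/(_ y (mem_index_enum y)); rewrite /= mulf_eq0 (negPf wxy) /=.
by rewrite mulf_eq0 orbb subr_eq0 => /eqP.
Qed.

Lemma dirichletD w h g t :
  dirichlet w (fun x => h x + t * g x) (fun x => h x + t * g x) =
  dirichlet w h h + 2 * t * dirichlet w g h + t ^+ 2 * dirichlet w g g.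
Proof.
rewrite /dirichlet !big_distrr -!big_split; apply: eq_bigr => x _.
by rewrite /= !big_distrr -!big_split; apply: eq_bigr => y _ /=; ring.
Qed.

Lemma dirichlet_affine w h a b :
  dirichlet w (fun x => a * (h x - b)) (fun x => a * (h x - b)) =
  a ^+ 2 * dirichlet w h h.
Proof.
rewrite /dirichlet !big_distrr; apply: eq_bigr => x _.
by rewrite /= !big_distrr; apply: eq_bigr => y _ /=; ring.
Qed.

(** Functions on [V] are encoded as row vectors, where closed bounded sets are compact. *)
Lemma continuous_dirichlet w :
  continuous (fun v : 'rV[R]_#|V| =>
    dirichlet w (fun x => v ord0 (enum_rank x)) (fun x => v ord0 (enum_rank x))).
Proof.
have coord x : continuous (fun v : 'rV[R]_#|V| => v ord0 (enum_rank x)).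
  exact: coord_continuous.
have addC : continuous (fun p : R * R => p.1 + p.2).
  by move=> p; apply: cvgD; [exact: cvg_fst|exact: cvg_snd].
apply: (continuous_big (op := +%R)) => [|x _].
  exact: addC.
apply: (continuous_big (op := +%R)) => [|y _].
  exact: addC.
pose diff (v : 'rV[R]_#|V|) : R := v ord0 (enum_rank x) - v ord0 (enum_rank y).
have diff_cont : continuous diff.
  by move=> v; apply: continuousB; apply: coord.
move=> v; apply: (@continuousM _ _ (fun=> w x y) (diff \* diff)).
  exact: cst_continuous.
by apply: continuousM; apply: diff_cont.
Qed.

Lemma rayleigh_minimiser w1 w2 : (1 < #|V|)%N -> 
    (forall x y, 0 <= w1 x y) -> (forall x y, 0 < w2 x y) ->
  exists (h : V -> R) (lam : R),
    [/\ 0 < dirichlet w2 h h, dirichlet w1 h h = lam * dirichlet w2 h h &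
        forall g, lam * dirichlet w2 g g <= dirichlet w1 g g].
Proof.
move=> /card_gt1P[x0 [x1 [_ _ x01]]] w1_ge0 w2_gt0.
have w2_ge0 x y := ltW (w2_gt0 x y).
pose val (v : 'rV[R]_#|V|) x := v ord0 (enum_rank x).
pose E w v := dirichlet w (val v) (val v).
(* The quotient is invariant under [g |-> a * (g - b)], so it suffices to
   minimise it on the compact set [K]. *)
pose K := [set v : 'rV[R]_#|V| | val v x0 = 0 /\ `|v| = 1].
have normalise g : dirichlet w2 g g != 0 ->
    exists2 v, K v & exists2 a, 0 < a & forall w, E w v = a * dirichlet w g g.
  move=> g0; pose u : 'rV[R]_#|V| := \row_i (g (enum_val i) - g x0).
  have u0 : u != 0.
    apply: contraNneq g0 => /rowP u0; apply/eqP.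
    apply: big1 => x _; apply: big1 => y _.
    have gE z : g z = g x0.
      by apply/eqP; rewrite -subr_eq0; have := u0 (enum_rank z);
        rewrite !mxE enum_rankK => ->.
    by rewrite !gE subrr mul0r mulr0.
  exists (`|u|^-1 *: u).
    split; first by rewrite /val !mxE enum_rankK subrr mulr0.
    by rewrite normrZ ger0_norm ?invr_ge0 // mulVf // normr_eq0.
  exists (`|u|^-1 ^+ 2) => [|w]; first by rewrite exprn_gt0 ?invr_gt0 ?normr_gt0.
  rewrite -(dirichlet_affine w g _ (g x0)) /E; congr dirichlet;
    by apply/funext => x; rewrite /val !mxE enum_rankK.
(* As [w2] is positive everywhere, zero energy forces a constant function, which vanishes at [x0],
   against norm 1. *)
have K_gt0 v : K v -> 0 < E w2 v.
  case=> v0 v1; rewrite lt_neqAle dirichlet_ge0 // andbT eq_sym.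
  apply/eqP => E0; have : v = 0.
    apply/rowP => i; rewrite mxE -(enum_valK i).
    rewrite -[LHS]/(val v _) (dirichlet_eq0 w2_ge0 E0 (y := x0)) //.
    by rewrite gt_eqF.
  by move=> v00; move: v1; rewrite v00 normr0 => /esym/eqP; rewrite oner_eq0.
have [h0 Kh0 h0_min] : exists2 c, c \in K &
    forall t, t \in K -> E w1 c / E w2 c <= E w1 t / E w2 t.
  apply: compact_EVT_min.
  - have [|v Kv _] := normalise (fun x => (x == x1)%:R); last by exists v.
    apply/eqP => /(dirichlet_eq0 w2_ge0) /(_ x0 x1); rewrite gt_eqF //.
    by move=> /(_ isT)/eqP; rewrite (negPf x01) eqxx eq_sym oner_eq0.
  - apply: bounded_closed_compact.
      exists 1; split=> // M M1 v [_ v1]; rewrite /= v1; exact: ltW.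
    apply: closedI.
      apply: (@preimage_closed _ _ (fun v => val v x0) [set 0]).
        by move=> v _; apply: coord_continuous.
      exact: closed_eq.
    apply: (@preimage_closed _ _ (fun v : 'rV[R]_#|V| => `|v|) [set 1]).
      by move=> v _; apply: norm_continuous.
    exact: closed_eq.
  - apply: continuous_in_subspaceT => v; rewrite inE => Kv.
    have contE w : continuous (E w) by exact: continuous_dirichlet.
    apply: (@continuousM _ _ (E w1) (fun v => (E w2 v)^-1)); first exact: contE.
    by apply: (@continuousV _ _ (E w2)); [rewrite gt_eqF // K_gt0|apply: contE].
rewrite inE in Kh0; have h0_gt0 := K_gt0 _ Kh0.
exists (val h0), (E w1 h0 / E w2 h0); split=> // [|g].
  by rewrite divfK // gt_eqF.
have [->|g0] := eqVneq (dirichlet w2 g g) 0; first by rewrite mulr0 dirichlet_ge0.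
have [v Kv [a a0 Ev]] := normalise g g0.
have := h0_min v; rewrite inE => /(_ Kv); rewrite !Ev.
have g_gt0 : 0 < dirichlet w2 g g by rewrite lt_neqAle eq_sym g0 dirichlet_ge0.
by rewrite -mulf_div divff ?gt_eqF // mul1r ler_pdivlMr.
Qed.

(** The form of [w1] minus [lam] times that of [w2] is nonnegative and vanishes at [h], so its
    derivative at [h] vanishes in the direction of each vertex indicator; Green's formula computes
    that derivative. *)
Lemma rayleigh_critical w1 w2 h lam :
    (forall x y, w1 x y = w1 y x) -> (forall x y, w2 x y = w2 y x) ->
    dirichlet w1 h h = lam * dirichlet w2 h h ->
    (forall g, lam * dirichlet w2 g g <= dirichlet w1 g g) ->
  forall z, \sum_y w1 z y * (h z - h y) = lam * \sum_y w2 z y * (h z - h y).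
Proof.
move=> w1C w2C hE hmin z; pose g x : R := (x == z)%:R.
have greenz w : (forall x y, w x y = w y x) ->
    dirichlet w g h = 2 * \sum_y w z y * (h z - h y).
  move=> wC; rewrite dirichlet_green // (bigD1 z) //= [X in _ + X]big1 ?addr0.
    by rewrite /g eqxx mul1r.
  by move=> x /negPf xz; rewrite /g xz mul0r.
pose b := dirichlet w1 g h - lam * dirichlet w2 g h.
pose c := dirichlet w1 g g - lam * dirichlet w2 g g.
have bc t : 0 <= 2 * t * b + t ^+ 2 * c.
  by have := hmin (fun x => h x + t * g x); rewrite !dirichletD hE /b /c; nra.
have b0 : b = 0.
  have c0 : 0 <= c by rewrite /c subr_ge0 hmin.
  have c1 : c + 1 != 0 by rewrite gt_eqF //; lra.
  (* The minimiser would be - b / c; the shift by 1 avoids a zero denominator and still makes the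
     value negative unless [b] is 0. *)
  have := bc (- b / (c + 1)).
  rewrite (_ : _ + _ = - (b ^+ 2 * ((c + 2) / (c + 1) ^+ 2))); last by field.
  rewrite oppr_ge0 pmulr_lle0; last by apply: divr_gt0; [lra|apply: exprn_gt0; lra].
  by move=> b2; apply/eqP; rewrite -sqrf_eq0 eq_le b2 sqr_ge0.
by move: b0; rewrite /b !greenz //; lra.
Qed.

End DirichletForm.

(** * The variational principle for [mu1] and the transfer to metric targets *)

Section SpectralGap.
Variables (R : realType) (V : finType) (e : rel V) (m : V -> V -> R).
Hypotheses (e_connected : connected_graph e) (V_gt1 : (1 < #|V|)%N).
Hypothesis m_weight : weight_function e m.

Local Notation mv := (vertex_weight m).
Local Notation M := (total_weight m).
Local Notation mm := (fun x y : V => mv x * mv y).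

Let mC x y : m x y = m y x. Proof. by case: m_weight. Qed.
Let m_ge0 x y : 0 <= m x y. Proof. by case: m_weight. Qed.

Lemma vertex_weight_gt0 x : 0 < mv x.
Proof.
have [y xy] : exists y, x != y.
  have /card_gt1P[y [z [_ _ yz]]] := V_gt1.
  by have [->|] := eqVneq x y; [exists z|exists y].
have /connectP[[|z p] /=] := e_connected x y.
  by move=> _ yx; rewrite yx eqxx in xy.
case/andP=> xz _ _; have [_ _ /(_ x z)] := m_weight; rewrite xz => mxz.
rewrite /vertex_weight (bigD1 z) //= ltr_pwDl ?sumr_ge0 //.
by rewrite lt_neqAle eq_sym mxz m_ge0.
Qed.

Lemma total_weight_gt0 : 0 < M.
Proof.
have /card_gt0P[x _] := ltnW V_gt1.
rewrite /total_weight (bigD1 x) //= ltr_pwDl ?vertex_weight_gt0 //.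
by apply: sumr_ge0 => y _; apply/ltW/vertex_weight_gt0.
Qed.

Lemma dirichlet_const (h : V -> R) : dirichlet m h h = 0 -> forall x y, h x = h y.
Proof.
move=> h0 x y; have /connectP[p] := e_connected x y.
elim: p x => [|z p IHp] x /=; first by move=> _ ->.
case/andP=> xz zp yE; rewrite -(IHp z zp yE).
by apply: (dirichlet_eq0 m_ge0 h0); have [_ _ ->] := m_weight.
Qed.

Lemma laplacianE (f : {ffun V -> R^o}) z :
  mv z * laplacian m f z = \sum_y m z y * (f z - f y).
Proof.
have mz := gt_eqF (vertex_weight_gt0 z).
rewrite ffunE; under [RHS]eq_bigr do rewrite mulrBr.
rewrite sumrB -big_distrl mulrBr big_distrr /=; congr (_ - _).
by apply: eq_bigr => y _; field; rewrite mz.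
Qed.

(** When the weighted mean of [h] is 0, only [mv z * M * h z] remains; this turns Rayleigh quotients
    into eigenvalues, with a factor [M]. *)
Lemma sum_product_weight (h : V -> R) z :
  \sum_y mm z y * (h z - h y) = mv z * (M * h z - \sum_y mv y * h y).
Proof.
rewrite -(eq_bigr _ (fun y _ => mulrA (mv z) (mv y) (h z - h y))) -big_distrr /=.
congr (_ * _); rewrite /total_weight big_distrl -sumrB.
by apply: eq_bigr => y _; rewrite mulrBr.
Qed.

(** An eigenfunction for a positive eigenvalue has weighted mean zero, so its Rayleigh quotient is
    exactly [a / M]. *)
Lemma eigenvalue_ge_rayleigh (lam a : R) :
    (forall g, lam * dirichlet mm g g <= dirichlet m g g) -> 0 < a ->
  passmx.leigenvalue (linfun (laplacian m)) a -> lam * M <= a.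
Proof.
move=> lam_min a0 /leigenvalue_laplacianP[f f0 fE].
have fsum z : \sum_y m z y * (f z - f y) = a * (mv z * f z).
  by rewrite -laplacianE fE ffunE mulrCA.
have mean0 : \sum_y mv y * f y = 0.
  (* Testing the eigenvalue equation against the constant 1 gives [a] times the weighted mean sum
     equal to 0. *)
  have := dirichlet_green (fun=> 1) f mC.
  rewrite [LHS]big1 => [|x _]; last by apply: big1 => y _; rewrite subrr mul0r mulr0.
  rewrite (eq_bigr (fun z => a * (mv z * f z))) => [|z _]; last by rewrite mul1r fsum.
  rewrite -big_distrr /= => /esym/eqP.
  by rewrite !mulf_eq0 pnatr_eq0 (gt_eqF a0) => /eqP.
pose N := \sum_x mv x * f x ^+ 2.
have Dm : dirichlet m f f = 2 * (a * N).
  rewrite dirichlet_green //; congr (_ * _); rewrite /N big_distrr.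
  by apply: eq_bigr => z _; rewrite fsum /=; ring.
have Dmm : dirichlet mm f f = 2 * (M * N).
  rewrite dirichlet_green; last by move=> x y; rewrite mulrC.
  congr (_ * _); rewrite /N big_distrr.
  by apply: eq_bigr => z _; rewrite sum_product_weight mean0 /=; ring.
have N0 : 0 < N.
  have N_ge0 x : true -> 0 <= mv x * f x ^+ 2.
    by rewrite mulr_ge0 ?sqr_ge0 // ltW ?vertex_weight_gt0.
  rewrite lt_neqAle sumr_ge0 // andbT eq_sym.
  apply: contra f0; rewrite psumr_eq0 // => /allP fz.
  apply/eqP/ffunP => x; rewrite ffunE; apply/eqP.
  have := fz x (mem_index_enum x).
  by rewrite /= mulf_eq0 (gt_eqF (vertex_weight_gt0 x)) sqrf_eq0.
have := lam_min f; rewrite Dm Dmm => le.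
by rewrite -(ler_pM2r N0); move: le; lra.
Qed.

Lemma mu1_spectral_gap :
  0 < mu1 m /\ forall h, mu1 m * dirichlet mm h h <= M * dirichlet m h h.
Proof.
have mm_gt0 x y : 0 < mm x y by rewrite mulr_gt0 ?vertex_weight_gt0.
have mmC x y : mm x y = mm y x by rewrite mulrC.
have M0 := total_weight_gt0.
have [h [lam [h0 hE h_min]]] := rayleigh_minimiser V_gt1 m_ge0 mm_gt0.
have lam0 : 0 < lam.
  rewrite -(pmulr_lgt0 _ h0) -hE lt_neqAle dirichlet_ge0 // andbT eq_sym.
  apply/eqP => /dirichlet_const hc; move: h0.
  rewrite [dirichlet _ _ _]big1 ?ltxx // => x _; apply: big1 => y _.
  by rewrite (hc x y) subrr !mulr0.
pose S := \sum_y mv y * h y.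
have lam_eig : passmx.leigenvalue (linfun (laplacian m)) (lam * M).
  (* The minimiser, recentred to weighted mean zero, is the eigenfunction. *)
  apply/leigenvalue_laplacianP; exists [ffun x => h x - S / M].
    apply/eqP => /ffunP f0; move: h0.
    have hc x : h x = S / M.
      by have := f0 x; rewrite !ffunE => /eqP; rewrite subr_eq0 => /eqP.
    rewrite [dirichlet _ _ _]big1 ?ltxx // => x _; apply: big1 => y _.
    by rewrite !hc subrr !mulr0.
  apply/ffunP => z; apply: (mulfI (lt0r_neq0 (vertex_weight_gt0 z))).
  rewrite laplacianE.
  rewrite (eq_bigr (fun y => m z y * (h z - h y))); last first.
    by move=> y _; rewrite !ffunE opprB addrA subrK.
  rewrite (rayleigh_critical mC mmC hE h_min) sum_product_weight -/S !ffunE.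
  by rewrite /GRing.scale /=; field; rewrite gt_eqF.
have mu1E : mu1 m = lam * M.
  apply/eqP; rewrite eq_le; apply/andP; split.
    apply: ge_inf; last by split=> //; rewrite mulr_gt0.
    by exists 0 => a [/ltW].
  apply: lb_le_inf; first by exists (lam * M); split=> //; rewrite mulr_gt0.
  by move=> a [a0 a_eig]; apply: eigenvalue_ge_rayleigh.
rewrite mu1E; split; first by rewrite mulr_gt0.
by move=> g; rewrite mulrAC mulrC ler_pM2l.
Qed.

(** The last hypothesis bounds the left side by averaged energies of the [F i], the real inequality
    passes from [mm] to [m], and the Lipschitz bound returns to [d] at the cost of the total mass of
    [p]. *)
Lemma poincare_transfer (I : finType) (p : I -> R) (F : I -> V -> R)
    (d : V -> V -> R) (K : R) : 0 <= K ->
    (forall i, 0 <= p i) ->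
    (forall i x y, `|F i x - F i y| <= d x y) ->
    (forall x y, d x y ^+ 2 <= K * \sum_i p i * (F i x - F i y) ^+ 2) ->
  M^-1 * (\sum_x \sum_y mv x * mv y * d x y ^+ 2) <=
  K * (\sum_i p i) / mu1 m * (\sum_x \sum_y m x y * d x y ^+ 2).
Proof.
move=> K0 p0 F_lip F_large; have [mu0 gap] := mu1_spectral_gap.
have M0 := total_weight_gt0.
set Dm := (X in _ <= _ * X); set Dmm := (X in _ * X <= _).
have le_m i : dirichlet m (F i) (F i) <= Dm.
  apply: ler_sum => x _; apply: ler_sum => y _; apply: ler_wpM2l => //.
  by rewrite -expr2 -real_normK ?num_real // ler_sqr ?nnegrE // (le_trans _ (F_lip i x y)).
have le_mm : Dmm <= K * \sum_i p i * dirichlet mm (F i) (F i).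
  rewrite /dirichlet.
  have -> : K * (\sum_i p i * \sum_x \sum_y mm x y * ((F i x - F i y) * (F i x - F i y)))
          = \sum_x \sum_y mm x y * (K * \sum_i p i * (F i x - F i y) ^+ 2).
    under eq_bigr do rewrite big_distrr /=.
    rewrite exchange_big big_distrr /=; apply: eq_bigr => x _.
    under eq_bigr do rewrite big_distrr /=.
    rewrite exchange_big big_distrr /=; apply: eq_bigr => y _.
    by rewrite !big_distrr /=; apply: eq_bigr => i _; ring.
  apply: ler_sum => x _; apply: ler_sum => y _; apply: ler_wpM2l (F_large x y).
  by rewrite mulr_ge0 ?ltW ?vertex_weight_gt0.
rewrite mulrC ler_pdivrMr //; apply: (le_trans le_mm).
rewrite -!mulrA; apply: ler_wpM2l => //.
rewrite big_distrl /=; apply: ler_sum => i _; apply: ler_wpM2l => //.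
rewrite -(ler_pM2l mu0) mulVKf ?gt_eqF //; apply: le_trans (gap (F i)) _.
by rewrite mulrC ler_pM2r.
Qed.

Lemma poincare_log (X : metricType R) L : (#|V| < 2 ^ L)%N ->
  poincare_inequality m X (2304 * L%:R ^+ 2 / mu1 m).
Proof.
move=> VL f; pose d x y : R := mdist (f x) (f y).
pose T := \sum_x \sum_y d x y.
have d_ge0 x y : 0 <= d x y := mdist_ge0 _ _.
have dT x y : d x y <= T.
  rewrite /T (bigD1 x) //= (bigD1 y) //= -addrA lerDl addr_ge0 ?sumr_ge0 //.
  by move=> z _; apply: sumr_ge0.
have dtri x y z : d x z <= d x y + d y z := metric_triangle _ _ _.
have dsym x y : d x y = d y x := metric_sym _ _.
pose p (i : 'I_L * {set V}) : R := bernoulli_weight (2 ^ i.1.+1)%:R^-1 i.2.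
have p0 i : 0 <= p i.
  by apply: bernoulli_weight_ge0; rewrite invr_ge0 ler0n invf_le1 ?ltr0n ?ler1n expn_gt0.
(* Each of the [L] scales has mass 1; this is the second factor [L] of the constant. *)
have sum_p : \sum_i p i = L%:R.
  rewrite -(pair_bigA _ (fun (j : 'I_L) A => p (j, A))) /=.
  under eq_bigr do rewrite /p /= sum_bernoulli_weight.
  by rewrite sumr_const card_ord.
have := @poincare_transfer _ p (fun i => set_dist d T i.2) d (2304 * L%:R).
rewrite sum_p (_ : 2304 * L%:R * L%:R = 2304 * L%:R ^+ 2); last by rewrite expr2 mulrA.
apply.
- by apply: mulr_ge0; apply: ler0n.
- exact: p0.
- by move=> i x y; apply: set_dist_lipschitz.
- move=> x y; rewrite -(pair_bigA _ (fun (j : 'I_L) A =>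
    p (j, A) * (set_dist d T A x - set_dist d T A y) ^+ 2)) /=.
  by apply: bourgain_l2 => // z; apply: mdistxx.
Qed.

(** Inverting [inf <= C] requires a positive infimum, because the inverse of 0 is 0 here. A map
    taking two distinct values bounds every admissible constant below by [lhs / rhs]. *)
Lemma nonlinear_spectral_gap_ge (X : metricType R) (C : R) :
    (exists p q : X, p != q) -> 0 < C -> poincare_inequality m X C ->
  C^-1 <= nonlinear_spectral_gap m X.
Proof.
move=> [p [q pq]] C0 PC.
have /card_gt1P[x0 [x1 [_ _ x01]]] := V_gt1.
pose f x := if x == x0 then p else q.
pose lhs := M^-1 * \sum_x \sum_y mv x * mv y * mdist (f x) (f y) ^+ 2.
pose rhs := \sum_x \sum_y m x y * mdist (f x) (f y) ^+ 2.
have lhs0 : 0 < lhs.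
  rewrite /lhs mulr_gt0 ?invr_gt0 ?total_weight_gt0 //.
  have ge0 x y : 0 <= mv x * mv y * mdist (f x) (f y) ^+ 2.
    by apply: mulr_ge0 (sqr_ge0 _); apply: mulr_ge0; apply/ltW/vertex_weight_gt0.
  rewrite (bigD1 x0) //= ltr_pwDl //; last first.
    by apply: sumr_ge0 => x _; apply: sumr_ge0.
  rewrite (bigD1 x1) //= ltr_pwDl ?sumr_ge0 //.
  rewrite /f eqxx eq_sym (negPf x01) mulr_gt0 ?exprn_gt0 ?mdist_gt0 //.
  by rewrite mulr_gt0 ?vertex_weight_gt0.
have rhs_ge0 : 0 <= rhs.
  by apply: sumr_ge0 => x _; apply: sumr_ge0 => y _; rewrite mulr_ge0 ?sqr_ge0.
have rhs0 : 0 < rhs.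
  by rewrite -(pmulr_rgt0 _ C0); apply: lt_le_trans lhs0 (PC f).
rewrite /nonlinear_spectral_gap lef_pV2 ?posrE //.
  by apply: ge_inf => //; exists 0 => c [/ltW].
apply: lt_le_trans (_ : lhs / rhs <= _); first by rewrite divr_gt0.
apply: lb_le_inf; first by exists C.
by move=> c [_ /(_ f)]; rewrite ler_pdivrMr.
Qed.

End SpectralGap.

Theorem proposition2p4 (R : realType) :
  exists2 c : R, 0 < c &
    forall (V : finType) (e : rel V) (m : V -> V -> R) (X : metricType R),
      simple_graph e ->
      connected_graph e ->
      (2 <= #|V|)%N ->
      weight_function e m ->
      (exists p q : X, p != q) ->
      c / (ln (#|V|%:R : R)) ^+ 2 <= nonlinear_spectral_gap m X / mu1 m.
Proof.
have ln2 : 0 < ln (2 : R) by rewrite ln_gt0 // ltr1n.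
have K0 : 0 < 2304 :> R by rewrite ltr0n.
(* With L = l + 1, where l >= 1 is the integer part of the binary logarithm of n, L <= 2 l gives L
   ln 2 <= 2 ln n; squaring produces the 4. *)
exists (ln 2 ^+ 2 / (4 * 2304)).
  by apply: divr_gt0; [apply: exprn_gt0|apply: mulr_gt0 K0; rewrite ltr0n].
move=> V e m X _ e_conn V2 m_weight pq.
pose l := trunc_log 2 #|V|.
have l0 : (0 < l)%N by rewrite trunc_log_gt0.
have [mu0 _] := mu1_spectral_gap e_conn V2 m_weight.
have L0 : 0 < (l.+1)%:R ^+ 2 :> R by rewrite exprn_gt0 // ltr0n.
have C0 : 0 < 2304 * (l.+1)%:R ^+ 2 / mu1 m :> R.
  by apply: divr_gt0 mu0; apply: mulr_gt0.
have VL : (#|V| < 2 ^ l.+1)%N := trunc_log_ltn _ (ltnSn 1).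
have gap := nonlinear_spectral_gap_ge e_conn V2 m_weight pq C0
  (poincare_log e_conn V2 m_weight VL).
have ln_l : ln 2 * (l.+1)%:R <= 2 * ln (#|V|%:R : R).
  have : ln (2 ^+ l : R) <= ln #|V|%:R.
    rewrite ler_ln ?posrE ?exprn_gt0 ?ltr0n //; last exact: ltnW.
    by rewrite -natrX ler_nat trunc_logP // ltnW.
  rewrite lnXn ?ltr0n // -[leLHS]mulr_natr => ln_l.
  have : (l.+1)%:R <= 2 * l%:R :> R by rewrite -natrM ler_nat mul2n -addnn -addn1 leq_add2l.
  by move=> /(ler_wpM2l (ltW ln2)); lra.
have lnV : 0 < ln (#|V|%:R : R) by rewrite ln_gt0 // ltr1n.
rewrite ler_pdivlMr //; apply: le_trans gap.
rewrite invf_div [leRHS]mulrC ler_pM2r //.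
rewrite ler_pdivrMr ?exprn_gt0 // ler_pdivrMr; last first.
  by apply: mulr_gt0 K0; rewrite ltr0n.
have -> : (2304 * l.+1%:R ^+ 2)^-1 * ln #|V|%:R ^+ 2 * (4 * 2304) =
    (2 * ln #|V|%:R) ^+ 2 / l.+1%:R ^+ 2 :> R.
  move: (2304 : R) K0 => K K0; field.
  by rewrite nat1r pnatr_eq0 (gt_eqF K0).
rewrite ler_pdivlMr // -exprMn ler_sqr ?nnegrE //; apply: mulr_ge0.
all: by rewrite ?ler0n // ltW.
Qed.
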